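(* There exists an integral feasible solution $(\tilde x,\tilde y)$ of $\textsc{FacilityMatLP}(w',\mathcal M)$ with $\mathrm{cost}_{w'}(\tilde x,\tilde y)\le(4\cdot3^{p-1}+2)\cdot3^p\cdot z^*$, where $z^*$ is the optimal value of $\textsc{FacilityMatLP}(w,\mathcal M)$.
   Context: Setting: $p\ge1$; a finite metric $d$ on $P\cup\mathcal F$; $f:\mathcal F\to\mathbb{R}_{\ge0}$; $w:P\to\mathbb{R}_{\ge0}$; matroid $\mathcal M$ on $\mathcal F$ with rank function $r$. $\mathrm{cost}_\omega(x,y)=\sum_uf(u)y_u+\sum_{v,u}\omega(v)d(v,u)^px_{vu}$; $\textsc{FacilityMatLP}(\omega,\mathcal M)$ minimizes it s.t. $\sum_ux_{vu}\ge1$ ($v\in P$), $\sum_{u\in S}y_u\le r(S)$ ($S\subseteq\mathcal F$), $0\le x_{vu}\le y_u$. Let $(x,y)$ be an optimal solution for $w$ with $\sum_ux_{vu}=1$ and $\mathcal R(v)=(\sum_ud(v,u)^px_{vu})^{1/p}$. The demands $w'$ come from client consolidation: order clients so that $\mathcal R(v_1)\le\dots\le\mathcal R(v_n)$; set $w'=w$; for $i=1,\dots,n-1$ and $j=i+1,\dots,n$: if $d(v_i,v_j)\le2^{(p+1)/p}\mathcal R(v_j)$ and $w'(v_i)>0$, set $w'(v_i)\leftarrow w'(v_i)+w'(v_j)$, $w'(v_j)\leftarrow0$. Assume the support of $w'$ has at least two clients. *)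

(* Defs.v *)
From HB Require Import structures.
From mathcomp Require Import all_boot all_order all_algebra.
From mathcomp Require Import all_classical all_reals all_analysis.
Set Implicit Arguments. Unset Strict Implicit. Unset Printing Implicit Defensive.
Import Order.TTheory GRing.Theory Num.Theory.
Local Open Scope ring_scope.

Section FacilityMat.
Variables (R : realType) (T : finType).

Definition metric_on (A : {set T}) (d : T -> T -> R) : Prop :=
  forall a b c, a \in A -> b \in A -> c \in A ->
    [/\ 0 <= d a b, (d a b = 0 <-> a = b), d a b = d b a
      & d a c <= d a b + d b c].

Definition matroid_rank (F : {set T}) (r : {set T} -> nat) : Prop :=
  [/\ forall S : {set T}, S \subset F -> (r S <= #|S|)%N,
      forall S S' : {set T}, S \subset S' -> S' \subset F -> (r S <= r S')%N
    & forall S S' : {set T}, S \subset F -> S' \subset F ->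
        (r (S :|: S') + r (S :&: S') <= r S + r S')%N].

Definition fm_cost (P F : {set T}) (d : T -> T -> R) (p : R) (f : T -> R)
  (om : T -> R) (x : T -> T -> R) (y : T -> R) : R :=
  \sum_(u in F) f u * y u
  + \sum_(v in P) \sum_(u in F) om v * (d v u `^ p) * x v u.

(* feasibility for FacilityMatLP(omega, M) (the constraints do not depend on omega) *)
Definition fm_feasible (P F : {set T}) (r : {set T} -> nat)
  (x : T -> T -> R) (y : T -> R) : Prop :=
  [/\ forall v, v \in P -> 1 <= \sum_(u in F) x v u,
      forall S : {set T}, S \subset F -> \sum_(u in S) y u <= (r S)%:R
    & forall v u, v \in P -> u \in F -> 0 <= x v u /\ x v u <= y u].

Definition fm_optimal P F r d p f om x y : Prop :=
  fm_feasible P F r x y /\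
  forall x' y', fm_feasible P F r x' y' ->
    fm_cost P F d p f om x y <= fm_cost P F d p f om x' y'.

Definition fm_integral (P F : {set T}) (x : T -> T -> R) (y : T -> R) : Prop :=
  (forall v u, v \in P -> u \in F -> x v u \is a Num.int) /\
  (forall u, u \in F -> y u \is a Num.int).

Definition client_radius (F : {set T}) (d : T -> T -> R) (p : R) (x : T -> T -> R)
  (v : T) : R :=
  (\sum_(u in F) (d v u `^ p) * x v u) `^ (p^-1).

Definition consol_step (d : T -> T -> R) (p : R) (rad : T -> R)
  (w : T -> R) (a b : T) : T -> R :=
  if (d a b <= 2 `^ ((p + 1) / p) * rad b) && (0 < w a) then
    fun z => if z == a then w a + w b else if z == b then 0 else w z
  else w.

(* the double loop: for i = 1..n-1, for j = i+1..n (in order) *)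
Fixpoint consolidate (d : T -> T -> R) (p : R) (rad : T -> R)
  (s : seq T) (w : T -> R) : T -> R :=
  match s with
  | [::] => w
  | a :: t => consolidate d p rad t (foldl (fun w' b => consol_step d p rad w' a b) w t)
  end.

End FacilityMat.

(* Main.v *)
(* Write C for the support of w', D_j for the distance from j to its nearest
   neighbour q(j) in C, and G_j for the facilities at distance < D_j / 2 from j.
   The balls G_j are disjoint, and since consolidation leaves
   D_j > 2^{(p+1)/p} R(j), Markov's inequality gives x(j, G_j) >= 1/2.  Choose
   pairs {a, q(a)} greedily by increasing D_a so that they are disjoint; then
   every pair {j, q(j)} meets a chosen pair {a, q(a)} with D_a <= D_j.  The
   fractional openings z_u = x_{ju} (u in G_j) satisfy the matroid constraints,
   z(G_j) <= 1, and z(G_a u G_{q(a)}) >= 1 for chosen pairs.  This is a matroid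
   polytope intersected with a laminar system, so its vertices are integral: at a
   fractional vertex the tight sets of either system induce a partition of the
   fractional coordinates, each constrained block of which has at least two
   elements, and a dimension count yields a nonzero direction of zero sum on all
   constrained blocks.  Hence z can be rounded without increasing the affine
   function which charges j the distance to its facility in G_j, or (5/2 D_j)^p
   if there is none; in the latter case the facility of a chosen pair is at
   distance at most D_j + D_a + D_a / 2 <= 5/2 D_j.  Altogether the cost is at
   most 5^p times the fractional one, and 5^p <= 9^p <= (4 3^{p-1} + 2) 3^p. *)

Require Import Defs.
From HB Require Import structures.
From mathcomp Require Import all_boot all_order all_algebra.
From mathcomp Require Import all_classical all_reals all_analysis.
From mathcomp Require Import zify ring lra.
Import mathcomp.boot.fintype mathcomp.boot.finset.
Import Order.TTheory GRing.Theory Num.Theory.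
Local Open Scope ring_scope.
Set Implicit Arguments. Unset Strict Implicit. Unset Printing Implicit Defensive.

(** * Minimizing a linear function at a vertex of a bounded polyhedron *)

Section Polyhedron.
Variables (R : realFieldType) (T I : finType) (a : I -> T -> R) (b : I -> R).

Local Notation dot c z := (\sum_u c u * z u).

Definition polyhedron (z : T -> R) := forall i, dot (a i) z <= b i.

(** The algebraic form of a vertex: the tight constraint vectors span the whole space. *)
Definition polyhedron_vertex (z : T -> R) :=
  forall h : T -> R, (forall i, dot (a i) z = b i -> dot (a i) h = 0) ->
    forall u, h u = 0.

Hypothesis pointed : forall h : T -> R,
  (exists u, h u != 0) -> exists i, 0 < dot (a i) h.

(** While [z] is not a vertex, some direction orthogonal to all tight constraints does not raise the
    cost; following it until a new constraint becomes tight lowers the number of slack ones.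
    [pointed] says that no ray stays in the polyhedron, so such a constraint is always met. *)
Lemma polyhedron_vertex_le (c z : T -> R) : polyhedron z ->
  exists z', [/\ polyhedron z', polyhedron_vertex z' & dot c z' <= dot c z].
Proof.
have [n] := ubnP #|[set i | dot (a i) z != b i]|.
elim: n z => // n IHn z; rewrite ltnS => ltn Pz.
have [vz|] := pselect (polyhedron_vertex z); first by exists z.
move/existsNP => [h0 /not_implyP[h0t /existsNP[u0 /eqP h0u]]].
have [h [ht hu hc]] : exists h : T -> R,
    [/\ forall i, dot (a i) z = b i -> dot (a i) h = 0, exists u, h u != 0
      & dot c h <= 0].
  have [c0|c0] := leP (dot c h0) 0; first by exists h0; split=> //; exists u0.
  have dotN e : dot e (fun u => - h0 u) = - dot e h0.
    by rewrite -sumrN; apply: eq_bigr => u _; rewrite mulrN.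
  exists (fun u => - h0 u); split; last by rewrite dotN oppr_le0 ltW.
    by move=> i /h0t h0i; rewrite dotN h0i oppr0.
  by exists u0; rewrite oppr_eq0.
have [i0 hi0] := pointed hu.
(* Ratio test: [t i] is the step length at which constraint [i] becomes tight along [h]; the
   smallest one over the increasing constraints keeps all others valid. *)
pose t i := (b i - dot (a i) z) / dot (a i) h.
have [i hi mini] := @arg_minP _ R I i0 (fun i => 0 < dot (a i) h) t hi0.
have t0 : 0 <= t i by apply: divr_ge0; [rewrite subr_ge0; apply: Pz|apply: ltW].
pose z' u := z u + t i * h u.
have dotz' e : dot e z' = dot e z + t i * dot e h.
  rewrite mulr_sumr -big_split /=; apply: eq_bigr => u _.
  by rewrite /z'; ring.
have Pz' : polyhedron z'.
  move=> k; rewrite dotz'; have [hk|hk] := ltP 0 (dot (a k) h).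
    have := mini _ hk; rewrite {2}/t ler_pdivlMr // => ?; lra.
  rewrite -[b k]addr0; apply: lerD; first exact: Pz.
  by rewrite mulr_ge0_le0.
have ltz' : (#|[set i | dot (a i) z' != b i]| < n)%N.
  apply: leq_trans ltn; apply: proper_card; apply/properP; split.
    apply/subsetP => k; rewrite !inE dotz'; apply: contra => /eqP bk.
    by rewrite (ht _ bk) mulr0 addr0 bk.
  exists i; rewrite !inE.
    by apply/eqP => /ht hi'; rewrite hi' ltxx in hi.
  by rewrite negbK dotz' /t (divfK (lt0r_neq0 hi)) addrC subrK.
have [z2 [Pz2 vz2 cz2]] := IHn _ ltz' Pz'.
exists z2; split=> //; apply: le_trans cz2 _.
by rewrite dotz' gerDl mulr_ge0_le0.
Qed.

End Polyhedron.

(** * A common kernel direction for two partitions *)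

Lemma card_imset_half (T K : finType) (U : {set T}) (c : T -> K) (N : {set K}) :
  (forall u, u \in U -> c u \in N ->
     exists v, [/\ v \in U, v != u & c v = c u]) ->
  (#|N :&: c @: U|.*2 <= #|[set u in U | c u \in N]|)%N.
Proof.
move=> two; rewrite -[X in (_ <= X)%N]sum1_card.
rewrite (partition_big c (mem (N :&: c @: U))) /=; last first.
  by move=> u; rewrite !inE => /andP[uU ->]; rewrite imset_f.
rewrite -muln2 -sum_nat_const; apply: leq_sum => k.
rewrite inE => /andP[kN /imsetP[u uU ku]].
have [|v [vU vu cv]] := two _ uU; first by rewrite -ku.
rewrite (bigD1 u) /=; last by rewrite inE uU ku eqxx andbT -ku.
by rewrite (bigD1 v) //= inE vU vu cv -ku kN eqxx.
Qed.

(** Each constrained class that meets [U] has at least two points there, so either family gives at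
    most half of [#|U|] equations. Fewer than [#|U|] equations leave a nonzero solution; exactly
    [#|U|] of them are dependent. *)
Lemma two_partitions_kernel (R : fieldType) (T K1 K2 : finType) (U : {set T})
    (c1 : T -> K1) (N1 : {set K1}) (c2 : T -> K2) (N2 : {set K2}) :
  U != set0 ->
  (forall u, u \in U -> c1 u \in N1 ->
     exists v, [/\ v \in U, v != u & c1 v = c1 u]) ->
  (forall u, u \in U -> c2 u \in N2 ->
     exists v, [/\ v \in U, v != u & c2 v = c2 u]) ->
  exists h : T -> R,
    [/\ exists u, h u != 0, forall u, u \notin U -> h u = 0,
        forall k, k \in N1 -> \sum_(u | c1 u == k) h u = 0
      & forall k, k \in N2 -> \sum_(u | c2 u == k) h u = 0].
Proof.
move=> U0 two1 two2.
have le1 := card_imset_half two1; have le2 := card_imset_half two2.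
have sub1 := subset_leq_card (subsetIl U [set u | c1 u \in N1]).
have sub2 := subset_leq_card (subsetIl U [set u | c2 u \in N2]).
have I1 : U :&: [set u | c1 u \in N1] = [set u in U | c1 u \in N1].
  by apply/setP => u; rewrite !inE.
have I2 : U :&: [set u | c2 u \in N2] = [set u in U | c2 u \in N2].
  by apply/setP => u; rewrite !inE.
set M1 := N1 :&: c1 @: U in le1; set M2 := N2 :&: c2 @: U in le2.
pose A1 : 'M[R]_(#|U|, #|M1|) := \matrix_(i, j) (c1 (enum_val i) == enum_val j)%:R.
pose A2 : 'M[R]_(#|U|, #|M2|) := \matrix_(i, j) (c2 (enum_val i) == enum_val j)%:R.
pose A := row_mx A1 A2.
have leM : (#|M1| + #|M2| <= #|U|)%N.
  rewrite -leq_double doubleD -[X in (_ <= X)%N]addnn.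
  by rewrite leq_add ?(leq_trans le1) ?(leq_trans le2) // -?I1 -?I2.
have nfree : ~~ row_free A.
  apply/negP => /eqP rA.
  have := rank_leq_col A; rewrite rA => leU.
  have eU : (#|M1| + #|M2|)%N = #|U| by apply/eqP; rewrite eqn_leq leM.
  have e1 : [set u in U | c1 u \in N1] = U.
    rewrite -I1; apply/eqP; rewrite eqEcard subsetIl /= I1.
    by rewrite I1 I2 in sub1 sub2; lia.
  have e2 : [set u in U | c2 u \in N2] = U.
    rewrite -I2; apply/eqP; rewrite eqEcard subsetIl /= I2.
    by rewrite I1 I2 in sub1 sub2; lia.
  have Ee (K : finType) (c : T -> K) (N : {set K}) (i : 'I_#|U|) :
      [set u in U | c u \in N] = U ->
      \sum_(j < #|N :&: c @: U|) (c (enum_val i) == enum_val j)%:R = 1 :> R.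
    move=> eN; have iU : enum_val i \in U := enum_valP i.
    have kM : c (enum_val i) \in N :&: c @: U.
      by rewrite inE imset_f // andbT; have /setP/(_ (enum_val i)) := eN; rewrite inE iU /=.
    rewrite (bigD1 (enum_rank_in kM (c (enum_val i)))) //= enum_rankK_in // eqxx.
    rewrite big1 ?addr0 // => j jr; case: eqP => // e.
    by move: jr; rewrite [X in enum_rank_in _ X]e enum_valK_in eqxx.
  (* With equality in the count, every element of U lies in one class of each
     kind, so the two families of class indicators have the same sum. *)
  pose e : 'cV[R]_(#|M1| + #|M2|) := col_mx (const_mx 1) (const_mx (-1)).
  have Ae : A *m e = 0.
    apply/matrixP => i j; rewrite mul_row_col !mxE.
    under eq_bigr do rewrite !mxE mulr1.
    under [X in _ + X]eq_bigr do rewrite !mxE mulrN1.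
    by rewrite sumrN !Ee // subrr.
  have /row_fullP[B BA] : row_full A by rewrite /row_full rA eU.
  have e0 : e = 0 by rewrite -[e]mul1mx -BA -mulmxA Ae mulmx0.
  have : (0 < #|M1| + #|M2|)%N by rewrite eU card_gt0.
  rewrite addn_gt0 => /orP[] /card_gt0P[k kM].
    have /matrixP/(_ (lshift _ (enum_rank_in kM k)) 0) := e0.
    by rewrite col_mxEu !mxE => /eqP; rewrite oner_eq0.
  have /matrixP/(_ (rshift _ (enum_rank_in kM k)) 0) := e0.
  by rewrite col_mxEd !mxE => /eqP; rewrite oppr_eq0 oner_eq0.
have : kermx A != 0 by rewrite kermx_eq0.
case/matrix0Pn => i0 [j0 nz].
pose v : 'I_#|U| -> R := fun j => kermx A i0 j.
have vA j : \sum_i v i * A i j = 0.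
  by have /matrixP/(_ i0 j) := mulmx_ker A; rewrite !mxE.
pose h u := \sum_i v i * (enum_val i == u)%:R.
have hsum (Q : pred T) : \sum_(u | Q u) h u = \sum_i v i * (Q (enum_val i))%:R.
  rewrite exchange_big /=; apply: eq_bigr => i _; rewrite -mulr_sumr; congr (_ * _).
  rewrite big_mkcond (bigD1 (enum_val i)) //= eqxx big1 ?addr0; first by case: (Q _).
  by move=> u nu; rewrite eq_sym (negPf nu); case: ifP.
have hU u : u \notin U -> h u = 0.
  move=> uU; rewrite /h big1 // => i _; case: eqP => [e|]; last by rewrite mulr0.
  by rewrite -e enum_valP in uU.
exists h; split=> //.
- exists (enum_val j0); rewrite /h (bigD1 j0) //= eqxx mulr1 big1 ?addr0 //.
  by move=> i ij; rewrite (inj_eq enum_val_inj) (negPf ij) mulr0.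
- move=> k kN; have [kU|kU] := boolP (k \in c1 @: U); last first.
    rewrite big1 // => u /eqP cu; apply: hU; apply: contra kU => uU.
    by rewrite -cu imset_f.
  have kM : k \in M1 by rewrite inE kN.
  rewrite hsum -[RHS](vA (lshift _ (enum_rank_in kM k))); apply: eq_bigr => i _.
  by rewrite row_mxEl mxE enum_rankK_in.
- move=> k kN; have [kU|kU] := boolP (k \in c2 @: U); last first.
    rewrite big1 // => u /eqP cu; apply: hU; apply: contra kU => uU.
    by rewrite -cu imset_f.
  have kM : k \in M2 by rewrite inE kN.
  rewrite hsum -[RHS](vA (rshift _ (enum_rank_in kM k))); apply: eq_bigr => i _.
  by rewrite row_mxEr mxE enum_rankK_in.
Qed.

(** * Integrality of a matroid polytope cut by a laminar system *)

Section ClassSums.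
Variables (R : archiRealFieldType) (T K : finType) (c : T -> K).

(** The last hypothesis makes [S] a union of whole classes, so its sum splits into vanishing class
    sums. *)
Lemma saturated_sum0 (h : T -> R) (N : {set K}) (S : {set T}) :
  (forall k, k \in N -> \sum_(u | c u == k) h u = 0) ->
  (forall u, u \in S -> c u \in N) ->
  (forall u v, u \in S -> c v = c u -> v \in S) ->
  \sum_(u in S) h u = 0.
Proof.
move=> h0 SN satS; rewrite (partition_big c predT) //= big1 // => k _.
have [/existsP[u /andP[uS /eqP uk]]|/existsPn nS] :=
  boolP [exists u, (u \in S) && (c u == k)]; last first.
  by rewrite big_pred0 // => u; apply/negbTE/nS.
rewrite -[RHS](h0 k) -?uk ?SN //; apply: eq_bigl => v.
by apply: andb_idl => /eqP cv; apply: satS cv.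
Qed.

(** Were [u] the only fractional point of its class, all other values would be 0 or 1, and
    integrality of the class sum would make [z u] an integer strictly between 0 and 1. *)
Lemma integral_class_two (z : T -> R) (u : T) :
  (forall v, 0 <= z v <= 1) -> 0 < z u < 1 ->
  \sum_(v | c v == c u) z v \is a Num.int ->
  exists v, [/\ v \in [set v | 0 < z v < 1], v != u & c v = c u].
Proof.
move=> z01 /andP[zu0 zu1] Iz.
have [/existsP[v /and3P[? ? /eqP ?]]|/existsPn no] :=
  boolP [exists v, [&& 0 < z v < 1, v != u & c v == c u]].
  by exists v; rewrite inE.
have Iu : z u \is a Num.int.
  move: Iz; rewrite (bigD1 u) //= rpredDr //.
  apply: rpred_sum => v /andP[/eqP cv vu].
  have := no v; rewrite vu cv eqxx !andbT negb_and -!leNgt.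
  have /andP[z0 z1] := z01 v => /orP[] zv.
    by have -> : z v = 0; [apply/eqP; rewrite eq_le zv z0 | apply: rpred0].
  by have -> : z v = 1; [apply/eqP; rewrite eq_le zv z1 | apply: rpred1].
by have := norm_intr_ge1 Iu (lt0r_neq0 zu0); rewrite gtr0_norm // leNgt zu1.
Qed.

End ClassSums.

(* The laminar system has two levels: the fibres of g, grouped by l. *)
Section LaminarMatroid.
Variables (R : archiRealFieldType) (T K L : finType) (r : {set T} -> nat).
Variables (g : T -> K) (l : K -> L) (A : {set K}) (B : {set L}).

Definition laminar_matroid_feasible (z : T -> R) : Prop :=
  [/\ forall u, 0 <= z u,
      forall S : {set T}, \sum_(u in S) z u <= (r S)%:R,
      forall k, k \in A -> \sum_(u | g u == k) z u <= 1
    & forall m, m \in B -> 1 <= \sum_(u | l (g u) == m) z u].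

Hypothesis rank1 : forall S : {set T}, (r S <= #|S|)%N.
Hypothesis submod : forall S S' : {set T},
  (r (S :|: S') + r (S :&: S') <= r S + r S')%N.

Let I : finType := (T + ({set T} + ({k | k \in A} + {m | m \in B})))%type.

Let a (i : I) (u : T) : R :=
  match i with
  | inl v => - (u == v)%:R
  | inr (inl X) => (u \in X)%:R
  | inr (inr (inl k)) => (g u == val k)%:R
  | inr (inr (inr m)) => - (l (g u) == val m)%:R
  end.

Let b (i : I) : R :=
  match i with
  | inl v => 0
  | inr (inl X) => (r X)%:R
  | inr (inr (inl k)) => 1
  | inr (inr (inr m)) => - 1
  end.

Let dot_pred (Q : pred T) (z : T -> R) :
  \sum_u (Q u)%:R * z u = \sum_(u | Q u) z u.
Proof.
rewrite [RHS]big_mkcond; apply: eq_bigr => u _.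
by case: (Q u); rewrite ?mul1r ?mul0r.
Qed.

Let dot_predN (Q : pred T) (z : T -> R) :
  \sum_u (- (Q u)%:R) * z u = - \sum_(u | Q u) z u.
Proof. by rewrite -dot_pred -sumrN; apply: eq_bigr => u _; rewrite mulNr. Qed.

Let feasibleP z : polyhedron a b z <-> laminar_matroid_feasible z.
Proof.
split=> [Pz|[z0 zr zA zB]].
  split=> [u|S|k kA|m mB].
  - by have := Pz (inl u); rewrite dot_predN big_pred1_eq oppr_le0.
  - by have := Pz (inr (inl S)); rewrite (dot_pred (mem S)).
  - have := Pz (inr (inr (inl (exist _ k kA)))).
    by rewrite (dot_pred (fun u => g u == k)).
  - have := Pz (inr (inr (inr (exist _ m mB)))).
    by rewrite (dot_predN (fun u => l (g u) == m)) lerN2.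
case=> [u|[S|[[k kA]|[m mB]]]] /=.
- by rewrite (dot_predN (pred1 u)) big_pred1_eq oppr_le0.
- by rewrite (dot_pred (mem S)); apply: zr.
- by rewrite (dot_pred (fun u => g u == k)) zA.
- by rewrite (dot_predN (fun u => l (g u) == m)) lerN2 zB.
Qed.

Let pointed (h : T -> R) :
  (exists u, h u != 0) -> exists i, 0 < \sum_u a i u * h u.
Proof.
case=> u; rewrite neq_lt => /orP[hu|hu].
  by exists (inl u); rewrite (dot_predN (pred1 u)) big_pred1_eq oppr_gt0.
by exists (inr (inl [set u])); rewrite (dot_pred (mem [set u])) big_set1.
Qed.

Section Vertex.
Variables (z : T -> R) (Fz : laminar_matroid_feasible z).

Let tight (S : {set T}) := \sum_(u in S) z u == (r S)%:R.

(** Uncrossing: the sums over union and intersection add up to those over [S] and [S'], while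
    submodularity bounds the total of their ranks from above, so both rank bounds are equalities. *)
Let tightUI S S' : tight S -> tight S' -> tight (S :|: S') && tight (S :&: S').
Proof.
case: Fz => _ zr _ _ /eqP tS /eqP tS'.
have sm : (r (S :|: S'))%:R + (r (S :&: S'))%:R <= (r S)%:R + (r S')%:R :> R.
  by rewrite -!natrD ler_nat.
have e : \sum_(u in S :|: S') z u + \sum_(u in S :&: S') z u
       = \sum_(u in S) z u + \sum_(u in S') z u.
  rewrite (big_setID S) /= setUK setDUl setDv set0U.
  by rewrite [\sum_(u in S') z u](big_setID S) /= (setIC S'); ring.
have := zr (S :|: S'); have := zr (S :&: S') => ? ?.
by rewrite /tight !eq_le !zr /=; apply/andP; split; lra.
Qed.

Let tight0 : tight set0.
Proof.
by have := rank1 set0; rewrite cards0 leqn0 => /eqP; rewrite /tight big_set0 => ->.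
Qed.

(** The least tight set containing [u]. If there is none, the empty intersection is the full set,
    which is then not tight, so [tight (hull u)] tells whether [u] lies in a tight set. *)
Let hull u : {set T} := \bigcap_(S | tight S && (u \in S)) S.

Let mem_hull u : u \in hull u.
Proof. by apply/bigcapP => S /andP[]. Qed.

Let hull_sub u S : tight S -> u \in S -> hull u \subset S.
Proof. by move=> tS uS; apply: bigcap_inf; rewrite tS. Qed.

Let tight_hull u S : tight S -> u \in S -> tight (hull u).
Proof.
(* Splitting off [S] lets the induction carry tightness of [S :&: _], whose base case [S :&: setT]
   holds even if [setT] is not tight. *)
move=> tS uS; rewrite /hull (bigD1 S) /= ?tS //.
elim/big_ind: _ => [|X Y tX tY|X /andP[/andP[tX _] _]].
- by rewrite setIT.
- by rewrite setIIr; have /andP[] := tightUI tX tY.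
- by have /andP[] := tightUI tS tX.
Qed.

(** Removing from [hull u] the union [W] of the hulls inside it that miss [u] leaves exactly the
    class of [u]. Both sets are tight, so the class sum is a difference of ranks. *)
Let hull_class_int u : tight (hull u) ->
  \sum_(v | hull v == hull u) z v \is a Num.int.
Proof.
move=> tu.
pose W := \bigcup_(v | (v \in hull u) && (u \notin hull v)) hull v.
have tW : tight W.
  apply: (big_ind (fun X => tight X)) => [|X Y tX tY|v /andP[vu _]] //.
    by have /andP[] := tightUI tX tY.
  exact: tight_hull tu vu.
have sW : W \subset hull u.
  by apply/bigcupsP => v /andP[vu _]; apply: hull_sub.
have e : \sum_(v | hull v == hull u) z v = \sum_(v in hull u :\: W) z v.
  apply: eq_bigl => v; rewrite !inE; apply/eqP/andP => [e|[vW vu]].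
    split; last by rewrite -e.
    apply/negP => /bigcupP[v' /andP[v'u /negP uv'] vv']; apply: uv'.
    apply: (subsetP (hull_sub (tight_hull tu v'u) vv')).
    by rewrite e.
  apply/eqP; rewrite eqEsubset (hull_sub tu vu) /=.
  apply: hull_sub (tight_hull tu vu) _; apply: contraR vW => uv.
  by apply/bigcupP; exists v; rewrite ?vu ?uv.
have /eqP := tu; rewrite (big_setID W) /= (setIidPr sW) (eqP tW) -e => eu.
have -> : \sum_(v | hull v == hull u) z v = (r (hull u))%:R - (r W)%:R.
  by rewrite -eu; ring.
by rewrite rpredB ?natr_int.
Qed.

Let tightA k := (k \in A) && (\sum_(u | g u == k) z u == 1).
Let tightB m := (m \in B) && (\sum_(u | l (g u) == m) z u == 1).

(** Tight fibres are blocks of their own, and what they leave of a group forms one more block, so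
    nested constraints become a partition. *)
Let cell u : K + L := if tightA (g u) then inl (g u) else inr (l (g u)).
Let tight_cells : {set K + L} :=
  [set c | match c with inl k => tightA k | inr m => tightB m end].

Let cell_inl u k : (cell u == inl k) = tightA k && (g u == k).
Proof.
rewrite /cell; have [<-|gk] := eqVneq (g u) k; first by case: ifP; rewrite ?eqxx.
by rewrite andbF; case: ifP => // _; apply: contraNF gk => /eqP[->].
Qed.

Let cell_inr u m : (cell u == inr m) = (l (g u) == m) && ~~ tightA (g u).
Proof. by rewrite /cell; case: ifP; rewrite ?andbF ?andbT. Qed.

(** The remainder of a tight group has sum 1 minus the number of tight fibres in that group. *)
Let cell_class_int u : cell u \in tight_cells ->
  \sum_(v | cell v == cell u) z v \is a Num.int.
Proof.
case: (cell u) => [k|m]; rewrite inE => tk.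
  under eq_bigl do rewrite cell_inl tk.
  by case/andP: tk => _ /eqP ->; apply: rpred1.
under eq_bigl do rewrite cell_inr.
case/andP: tk => _ /eqP tm.
have := tm; rewrite (bigID (fun v => tightA (g v))) /= => eA.
suff IA : \sum_(v | (l (g v) == m) && tightA (g v)) z v \is a Num.int.
  by rewrite -(rpredDl _ IA) eA rpred1.
rewrite (partition_big g (fun k => (l k == m) && tightA k)) //=.
apply: rpred_sum => k /andP[lk tk].
have -> : \sum_(v | (l (g v) == m) && tightA (g v) && (g v == k)) z v
        = \sum_(v | g v == k) z v.
  by apply: eq_bigl => v; apply: andb_idl => /eqP ->; rewrite lk tk.
by case/andP: tk => _ /eqP ->; apply: rpred1.
Qed.

(** Every tight rank, fibre or group constraint sums over whole constrained blocks, and tight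
    nonnegativity concerns only coordinates outside [U]. The kernel direction [h] is thus orthogonal
    to all tight constraints, against the vertex property. *)
Lemma laminar_matroid_vertex_integral :
  polyhedron_vertex a b z -> forall u, z u = 0 \/ z u = 1.
Proof.
case: (Fz) => z0 zr zA zB vz u0.
have z01 u : 0 <= z u <= 1.
  rewrite z0 /=; have := zr [set u]; rewrite big_set1 => /le_trans; apply.
  by rewrite lern1 (leq_trans (rank1 _)) ?cards1.
pose U := [set u | 0 < z u < 1].
have [U0|] := eqVneq U set0.
  have /setP/(_ u0) := U0; rewrite !inE.
  have /andP[zu0 zu1] := z01 u0; move/negbT; rewrite negb_and -!leNgt.
  by case/orP => zu; [left | right]; apply/eqP; rewrite eq_le zu ?zu0 ?zu1.
move=> U0.
have [||h [[u hu] hU h1 h2]] := @two_partitions_kernel R T _ _ U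
    hull [set X | tight X] cell tight_cells U0.
- move=> u; rewrite !inE => uU tu.
  exact: integral_class_two z01 uU (hull_class_int tu).
- move=> u; rewrite inE => uU tu.
  exact: integral_class_two z01 uU (cell_class_int tu).
case/eqP: hu; apply: vz => {u}; case=> [u|[X|[[k kA]|[m mB]]]] /=.
- rewrite !(dot_predN (pred1 u)) !big_pred1_eq => /eqP; rewrite oppr_eq0 => /eqP zu.
  by rewrite hU ?oppr0 // inE zu ltxx.
- rewrite !(dot_pred (mem X)) => /eqP tX.
  apply: (saturated_sum0 h1) => [u uX|u v uX vu].
    by rewrite inE (tight_hull tX).
  by apply: (subsetP (hull_sub tX uX)); rewrite -vu.
- rewrite !(dot_pred (fun u => g u == k)) => tk.
  have tk' : tightA k by rewrite /tightA kA tk eqxx.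
  rewrite -[RHS](h2 (inl k)) ?inE //; apply: eq_bigl => u.
  by rewrite cell_inl tk'.
- rewrite !(dot_predN (fun u => l (g u) == m)) => /oppr_inj tm.
  apply/eqP; rewrite oppr_eq0; apply/eqP.
  have tm' : tightB m by rewrite /tightB mB tm eqxx.
  have -> : \sum_(u | l (g u) == m) h u = \sum_(u in [set u | l (g u) == m]) h u.
    by apply: eq_bigl => u; rewrite inE.
  apply: (saturated_sum0 h2) => [u|u v].
    by rewrite !inE /cell => /eqP lu; case: ifP => // _; rewrite lu.
  rewrite !inE {2}/cell => /eqP lu; case: ifP => _ /eqP.
    by rewrite cell_inl => /andP[_ /eqP ->]; rewrite lu.
  by rewrite cell_inr lu => /andP[].
Qed.

End Vertex.

Theorem laminar_matroid_rounding (c z : T -> R) : laminar_matroid_feasible z ->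
  exists z', [/\ laminar_matroid_feasible z', forall u, z' u = 0 \/ z' u = 1
    & \sum_u c u * z' u <= \sum_u c u * z u].
Proof.
move=> /feasibleP Pz; have [z' [Pz' vz' cz']] := polyhedron_vertex_le pointed c Pz.
have Fz' := (feasibleP z').1 Pz'.
by exists z'; split=> //; apply: laminar_matroid_vertex_integral.
Qed.

End LaminarMatroid.

(** * Effect of client consolidation on separation and cost *)

Section Consolidation.
Variables (R : realType) (T : finType) (d : T -> T -> R) (p : R) (rad : T -> R).

Local Notation step := (consol_step d p rad).
Local Notation merge a := (foldl (fun w' b => step w' a b)).
Local Notation consol := (consolidate d p rad).
Local Notation near a b := (d a b <= 2 `^ ((p + 1) / p) * rad b).

Lemma consol_step_eq0 w a b z : w z = 0 -> step w a b z = 0.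
Proof.
rewrite /consol_step; case: ifP => // /andP[_ wa] wz.
by case: eqP => [za|_]; [rewrite -za wz ltxx in wa | case: eqP].
Qed.

Lemma consol_step_ge0 (A : {set T}) w a b : a \in A -> b \in A ->
  (forall z, z \in A -> 0 <= w z) -> forall z, z \in A -> 0 <= step w a b z.
Proof.
move=> aA bA w0 z zA; rewrite /consol_step; case: ifP => _; last exact: w0.
by case: ifP => _; [rewrite addr_ge0 ?w0 | case: ifP => _ //; apply: w0].
Qed.

Lemma merge_eq0 w a t z : w z = 0 -> merge a w t z = 0.
Proof. by elim: t w => //= b t IHt w wz; apply/IHt/consol_step_eq0. Qed.

Lemma merge_ge0 (A : {set T}) w a t : a \in A -> {subset t <= A} ->
  (forall z, z \in A -> 0 <= w z) -> forall z, z \in A -> 0 <= merge a w t z.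
Proof.
move=> aA; elim: t w => //= b t IHt w sA w0; apply: IHt.
  by move=> z zt; apply: sA; rewrite inE zt orbT.
by apply: consol_step_ge0 => //; apply: sA; rewrite inE eqxx.
Qed.

(* If w a vanished when b is reached, it stays 0; otherwise b is merged into a. *)
Lemma merge_near (A : {set T}) w a t b : a \in A -> {subset t <= A} ->
  (forall z, z \in A -> 0 <= w z) -> a \notin t -> b \in t -> near a b ->
  merge a w t a = 0 \/ merge a w t b = 0.
Proof.
move=> aA; elim: t w => //= c t IHt w sA w0; rewrite inE negb_or => /andP[ac at_].
have cA : c \in A by apply: sA; rewrite inE eqxx.
rewrite inE => /orP[/eqP -> nab|bt nab]; last first.
  apply: IHt => //; last exact: consol_step_ge0.
  by move=> z zt; apply: sA; rewrite inE zt orbT.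
have [wa|wa] := leP (w a) 0.
  left; apply/merge_eq0/consol_step_eq0/eqP.
  by rewrite eq_le wa w0.
right; apply: merge_eq0; rewrite /consol_step nab wa /=.
by rewrite eq_sym (negPf ac) eqxx.
Qed.

Lemma consolidate_eq0 s w z : w z = 0 -> consol s w z = 0.
Proof. by elim: s w => //= a t IHt w wz; apply/IHt/merge_eq0. Qed.

Lemma consolidate_ge0 (A : {set T}) s w : {subset s <= A} ->
  (forall z, z \in A -> 0 <= w z) -> forall z, z \in A -> 0 <= consol s w z.
Proof.
elim: s w => //= a t IHt w sA w0.
have sA' : {subset t <= A} by move=> z zt; apply: sA; rewrite inE zt orbT.
by apply: IHt => //; apply: merge_ge0 => //; apply: sA; rewrite inE eqxx.
Qed.

(** After the pass of [a], one of [a] and a later [b] near it has weight zero, and later passes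
    never revive a zero weight. *)
Lemma consolidate_separated (A : {set T}) s w : uniq s -> {subset s <= A} ->
  (forall z, z \in A -> 0 <= w z) ->
  pairwise (fun a b => [|| ~~ near a b, consol s w a == 0 | consol s w b == 0]) s.
Proof.
elim: s w => //= a t IHt w /andP[at_ ut] sA w0.
have sA' : {subset t <= A} by move=> z zt; apply: sA; rewrite inE zt orbT.
have aA : a \in A by apply: sA; rewrite inE eqxx.
rewrite IHt ?andbT //; last exact: merge_ge0.
apply/allP => b bt; case: (boolP (near a b)) => //= nab.
by have [e|e] := merge_near aA sA' w0 at_ bt nab;
  rewrite (consolidate_eq0 _ e) eqxx ?orbT.
Qed.

Lemma merge_sum_le (A : {set T}) (phi : T -> R) w a t :
  a \in A -> {subset t <= A} -> (forall z, z \in A -> 0 <= w z) ->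
  a \notin t -> all (fun b => phi a <= phi b) t ->
  \sum_(v in A) merge a w t v * phi v <= \sum_(v in A) w v * phi v.
Proof.
move=> aA; elim: t w => //= b t IHt w sA w0.
rewrite inE negb_or => /andP[ab at_] /andP[phiab phit].
have bA : b \in A by apply: sA; rewrite inE eqxx.
apply: le_trans (IHt _ _ _ at_ phit) _.
- by move=> z zt; apply: sA; rewrite inE zt orbT.
- exact: consol_step_ge0.
rewrite /consol_step; case: ifP => // _.
have D (F : T -> R) : \sum_(v in A) F v
    = F a + (F b + \sum_(v in A | (v != a) && (v != b)) F v).
  rewrite (bigD1 a) //= (bigD1 b) /=; last by rewrite bA eq_sym.
  by congr (_ + (_ + _)); apply: eq_bigl => v; rewrite andbA.
rewrite !D eqxx (eq_sym b) (negPf ab) eqxx mul0r add0r.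
rewrite [X in _ + X <= _](eq_bigr (fun v => w v * phi v)); last first.
  by move=> v /and3P[_ /negPf -> /negPf ->].
rewrite mulrDl -addrA lerD2l lerD2r.
by apply: ler_wpM2l => //; apply: w0.
Qed.

Lemma consolidate_sum_le (A : {set T}) (phi : T -> R) s w :
  uniq s -> {subset s <= A} -> (forall z, z \in A -> 0 <= w z) ->
  pairwise (fun a b => phi a <= phi b) s ->
  \sum_(v in A) consol s w v * phi v <= \sum_(v in A) w v * phi v.
Proof.
elim: s w => //= a t IHt w /andP[at_ ut] sA w0 /andP[phia phit].
have sA' : {subset t <= A} by move=> z zt; apply: sA; rewrite inE zt orbT.
have aA : a \in A by apply: sA; rewrite inE eqxx.
by apply: le_trans (IHt _ ut sA' (merge_ge0 aA sA' w0) phit) _; apply: merge_sum_le.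
Qed.

End Consolidation.

(** * Greedy selection and nearest neighbours *)

Lemma pairwise_or (T : eqType) (e : rel T) s a b : pairwise e s ->
  a \in s -> b \in s -> a != b -> e a b || e b a.
Proof.
elim: s => //= c s IHs /andP[/allP ec es]; rewrite !inE.
case/predU1P => [->|a_s]; case/predU1P => [->|b_s]; rewrite ?eqxx //.
- by rewrite ec.
- by rewrite ec ?orbT.
- exact: IHs.
Qed.

(** Pick an element of least [key], discard everything related to it, and recurse: a discarded
    element is dominated by the one that discarded it. *)
Lemma greedy_independent_dominating (R : realDomainType) (T : finType)
    (e : rel T) (key : T -> R) (A : {set T}) : reflexive e -> symmetric e ->
  exists M : {set T}, [/\ M \subset A,
    forall a b, a \in M -> b \in M -> e a b -> a = b
  & forall j, j \in A -> exists a, [/\ a \in M, key a <= key j & e a j]].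
Proof.
move=> eR eS; have [n] := ubnP #|A|; elim: n A => // n IHn A; rewrite ltnS => leA.
have [->|[j0 j0A]] := set_0Vmem A.
  by exists set0; split=> // [a b|j]; rewrite inE.
have [a aA mina] := @arg_minP _ R T j0 (mem A) key j0A.
have ltA : (#|[set j in A | ~~ e a j]| < n)%N.
  apply: leq_trans leA; apply: proper_card; apply/properP; split.
    by apply/subsetP => j; rewrite inE => /andP[].
  by exists a => //; rewrite inE eR andbF.
have [M [sM indM domM]] := IHn _ ltA.
have nM b : b \in M -> (b \in A) && ~~ e a b.
  by move=> /(subsetP sM); rewrite inE.
exists (a |: M); split.
- by apply/subsetP => b; rewrite !inE => /predU1P[->|/nM/andP[]].
- move=> b c; rewrite !inE => /predU1P[->|bM] /predU1P[->|cM] //.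
  + by have /andP[_ /negPf ->] := nM _ cM.
  + by rewrite eS; have /andP[_ /negPf ->] := nM _ bM.
  + exact: indM.
- move=> j jA; have [eaj|naj] := boolP (e a j).
    by exists a; split=> //; [rewrite setU11 | apply: mina].
  have [|b [bM kb ebj]] := domM j; first by rewrite inE jA.
  by exists b; rewrite setU1r.
Qed.

Lemma exists_nearest_neighbour (R : realType) (T : finType) (C : {set T})
    (d : T -> T -> R) : (2 <= #|C|)%N ->
  exists q : T -> T, forall j, j \in C ->
    [/\ q j \in C, q j != j
      & forall k, k \in C -> k != j -> d j (q j) <= d j k].
Proof.
move=> C2.
suff /choice[q qP] : forall j, exists k, j \in C ->
    [/\ k \in C, k != j & forall k', k' \in C -> k' != j -> d j k <= d j k'].
  by exists q.
move=> j; have [jC|] := boolP (j \in C); last by exists j.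
have /card_gt0P[k0 k0C] : (0 < #|C :\ j|)%N by have := cardsD1 j C; rewrite jC; lia.
have [k kC mink] := @arg_minP _ R T k0 (fun k => k \in C :\ j) (d j) k0C.
move: kC; rewrite /= !inE => /andP[kj kC].
by exists k => _; split=> // k' k'C k'j; apply: mink; rewrite /= !inE k'j.
Qed.

(** * Rounding when the clients of positive weight are far apart *)

Section SeparatedRounding.
Variables (R : realType) (T : finType) (P F : {set T}) (d : T -> T -> R) (p : R).
Variables (f om : T -> R) (r : {set T} -> nat) (x : T -> T -> R) (y : T -> R).
Hypothesis p0 : 0 < p.
Hypothesis dm : metric_on (P :|: F) d.
Hypothesis f0 : forall u, u \in F -> 0 <= f u.
Hypothesis om0 : forall v, v \in P -> 0 <= om v.
Hypothesis rM : matroid_rank F r.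
Hypothesis xy : fm_feasible P F r x y.
Hypothesis x1 : forall v, v \in P -> \sum_(u in F) x v u = 1.

Let C := [set v in P | 0 < om v].
Hypothesis C2 : (2 <= #|C|)%N.

(** The [p]-th power of the client radius; [sep] is the separation inequality raised to the power
    [p]. *)
Let avg j := \sum_(u in F) d j u `^ p * x j u.
Hypothesis sep : forall a b, a \in C -> b \in C -> a != b ->
  2 `^ (p + 1) * avg a < d a b `^ p.

Variable q : T -> T.
Hypothesis qP : forall j, j \in C ->
    [/\ q j \in C, q j != j
      & forall k, k \in C -> k != j -> d j (q j) <= d j k].

Let D j := d j (q j).
Let inball j u := 2 * d j u < D j.

Let CP j : j \in C -> j \in P. Proof. by rewrite inE => /andP[]. Qed.
Let CPF j : j \in C -> j \in P :|: F. Proof. by move=> /CP; rewrite inE => ->. Qed.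
Let FPF j : j \in F -> j \in P :|: F. Proof. by rewrite inE orbC => ->. Qed.

Let d0 a b : a \in P :|: F -> b \in P :|: F -> 0 <= d a b.
Proof. by move=> aA bA; have [] := dm aA bA bA. Qed.
Let dC a b : a \in P :|: F -> b \in P :|: F -> d a b = d b a.
Proof. by move=> aA bA; have [] := dm aA bA bA. Qed.
Let dT a b c : a \in P :|: F -> b \in P :|: F -> c \in P :|: F ->
  d a c <= d a b + d b c.
Proof. by move=> aA bA cA; have [] := dm aA bA cA. Qed.

Let D0 j : j \in C -> 0 <= D j.
Proof. by move=> jC; have [qC _ _] := qP jC; apply: d0; apply: CPF. Qed.

Let D_q j : j \in C -> D (q j) <= D j.
Proof.
move=> jC; have [qC qj _] := qP jC; have [_ _ mq] := qP qC.
by rewrite {2}/D dC ?CPF //; apply: mq => //; rewrite eq_sym.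
Qed.

Let g u : option T := [pick j | [&& j \in C, u \in F & inball j u]].

(** The balls are disjoint, so [pick] has at most one candidate: a common facility of the balls of
    [j] and [k] would give [2 * d j k < D j + D k], while [D j] and [D k] are both at most
    [d j k]. *)
Let g_eq u j : (g u == Some j) = [&& j \in C, u \in F & inball j u].
Proof.
rewrite /g; case: pickP => [k /and3P[kC uF bk]|no]; last by rewrite no.
have [<-|kj] := eqVneq k j; first by rewrite eqxx kC uF bk.
rewrite (inj_eq Some_inj) (negPf kj) uF /=; apply/esym/negbTE/negP.
move=> /andP[jC bj].
have := dT (CPF kC) (FPF uF) (CPF jC); rewrite (dC (FPF uF) (CPF jC)).
have [_ _ mk] := qP kC; have [_ _ mj] := qP jC.
have := mk j jC; rewrite eq_sym kj => /(_ isT).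
have := mj k kC kj; rewrite (dC (CPF jC) (CPF kC)).
move: bk bj; rewrite /inball /D; lra.
Qed.

Let sum_g j (h : T -> R) : j \in C ->
  \sum_(u | g u == Some j) h u = \sum_(u in F | inball j u) h u.
Proof. by move=> jC; apply: eq_bigl => u; rewrite g_eq jC. Qed.

Let outx j := \sum_(u in F | ~~ inball j u) x j u.
Let outR j := \sum_(u in F | ~~ inball j u) d j u `^ p * x j u.
Let inx j := \sum_(u in F | inball j u) x j u.
Let inR j := \sum_(u in F | inball j u) d j u `^ p * x j u.

Let x0 j u : j \in C -> u \in F -> 0 <= x j u.
Proof. by case: xy => _ _ H jC uF; have [] := H j u (CP jC) uF. Qed.

Let x_in_out j : j \in C -> inx j = 1 - outx j.
Proof.
move=> jC; have := x1 (CP jC).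
rewrite (bigID (inball j)) /= -/(inx j) -/(outx j) => <-; ring.
Qed.

Let avg_in_out j : avg j = inR j + outR j.
Proof. by rewrite /avg (bigID (inball j)). Qed.

Let outx0 j : j \in C -> 0 <= outx j.
Proof. by move=> jC; apply: sumr_ge0 => u /andP[uF _]; apply: x0. Qed.

Let inR0 j : j \in C -> 0 <= inR j.
Proof.
by move=> jC; apply: sumr_ge0 => u /andP[uF _]; rewrite mulr_ge0 ?powR_ge0 ?x0.
Qed.

(** Markov's inequality: [D j <= 2 * d j u] outside the ball. *)
Let outx_le j : j \in C -> D j `^ p * outx j <= 2 `^ p * outR j.
Proof.
move=> jC; rewrite !mulr_sumr; apply: ler_sum => u /andP[uF].
rewrite -leNgt => Dd; rewrite mulrA ler_wpM2r ?x0 //.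
have dju : 0 <= d j u := d0 (CPF jC) (FPF uF).
rewrite -powRM //; apply: ge0_ler_powR; rewrite ?nnegrE ?D0 ?mulr_ge0 //.
exact: ltW.
Qed.

(** An outside mass above 1/2 would bound the [p]-th power of [D j] by [2^(p+1) * avg j], against
    [sep]; the extra factor 2 in [sep] is what yields one half. *)
Let outx_half j : j \in C -> outx j <= 2^-1.
Proof.
move=> jC; have := outx_le jC; have := inR0 jC.
have [qC qj _] := qP jC.
have := sep jC qC; rewrite eq_sym qj => /(_ isT); rewrite -/(D j).
rewrite avg_in_out powRD ?powRr1 //; last by apply/implyP => _; rewrite pnatr_eq0.
have : 0 < 2 `^ p :> R by rewrite powR_gt0.
set t := 2 `^ p; set X := D j `^ p => t0 s1 i0 s2.
rewrite leNgt; apply/negP => o2.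
have X0 : 0 <= X := powR_ge0 _ _.
have : X * 2^-1 <= X * outx j by rewrite ler_wpM2l // ltW.
have : 0 <= t * inR j by rewrite mulr_ge0 // ltW.
by move: s1; rewrite mulrDr; lra.
Qed.

Let reroute j := (5 / 2 * D j) `^ p.

Let charge (z : T -> R) j :=
  \sum_(u | g u == Some j) d j u `^ p * z u
  + reroute j * (1 - \sum_(u | g u == Some j) z u).

Let potential (z : T -> R) :=
  \sum_(u in F) f u * z u + \sum_(j in C) om j * charge z j.

(** The linear part of [potential]; what is left over does not depend on [z], so rounding with a
    linear objective suffices. *)
Let coeff u : R := (if u \in F then f u else 0)
  + (if g u is Some j then om j * (d j u `^ p - reroute j) else 0).

Let potentialE z :
  potential z = \sum_u coeff u * z u + \sum_(j in C) om j * reroute j.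
Proof.
have -> : \sum_u coeff u * z u = \sum_(u in F) f u * z u
    + \sum_(j in C) \sum_(u | g u == Some j) om j * (d j u `^ p - reroute j) * z u.
  under [X in _ = _ + X]eq_bigr do rewrite big_mkcond.
  rewrite exchange_big /= [X in _ = X + _]big_mkcond -big_split /=.
  apply: eq_bigr => u _; rewrite mulrDl; congr (_ + _).
    by case: ifP; rewrite ?mul0r.
  case E : (g u) => [j|]; last by rewrite mul0r big1.
  have /and3P[jC _ _] : [&& j \in C, u \in F & inball j u] by rewrite -g_eq E.
  rewrite (bigD1 j) //= eqxx big1 ?addr0 // => k /andP[_ kj].
  by rewrite (inj_eq Some_inj) eq_sym (negPf kj).
rewrite /potential -addrA; congr (_ + _); rewrite -big_split /=.
apply: eq_bigr => j _; rewrite /charge.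
rewrite -(eq_bigr _ (fun u _ => mulrA (om j) _ (z u))) -mulr_sumr.
under [in RHS]eq_bigr do rewrite mulrBl.
by rewrite sumrB -mulr_sumr; ring.
Qed.

Let z0 u : R := if g u is Some j then x j u else 0.

Let sum_z0 j : j \in C -> \sum_(u | g u == Some j) z0 u = inx j.
Proof.
move=> jC; rewrite /inx -sum_g //; apply: eq_bigr => u /eqP gu.
by rewrite /z0 gu.
Qed.

Let powR5 : 5 `^ p = (5 / 2) `^ p * 2 `^ p :> R.
Proof. by rewrite -powRM ?divr_ge0 // divfK ?pnatr_eq0. Qed.

Let powR5_ge1 : 1 <= 5 `^ p :> R.
Proof.
by rewrite -[X in X <= _](powRr0 5) ler_powR ?ler1n // ltW.
Qed.

(** Mass inside the ball pays its own distance; mass outside pays [(5/2 * D j)^p], which Markov's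
    inequality turns into [5^p] times its own share of [avg j]. *)
Let charge_z0 j : j \in C -> charge z0 j <= 5 `^ p * avg j.
Proof.
move=> jC; rewrite /charge sum_z0 // x_in_out // avg_in_out.
have -> : \sum_(u | g u == Some j) d j u `^ p * z0 u = inR j.
  rewrite /inR -sum_g //; apply: eq_bigr => u /eqP gu; by rewrite /z0 gu.
have -> : 1 - (1 - outx j) = outx j by ring.
rewrite mulrDr; apply: lerD.
  by rewrite ler_peMl ?inR0.
rewrite /reroute powRM ?divr_ge0 ?D0 // powR5 -!mulrA ler_wpM2l ?powR_ge0 //.
exact: outx_le.
Qed.

Let C_inh : exists j, j \in C.
Proof. by apply/card_gt0P; apply: leq_trans C2. Qed.

Let z0_ge0 u : 0 <= z0 u.
Proof.
rewrite /z0; case E : (g u) => [j|] //.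
have /and3P[jC uF _] : [&& j \in C, u \in F & inball j u] by rewrite -g_eq E.
exact: x0.
Qed.

Let z0_le u : u \in F -> z0 u <= y u.
Proof.
case: xy => _ _ H uF; rewrite /z0; case E : (g u) => [j|].
  have /and3P[jC _ _] : [&& j \in C, u \in F & inball j u] by rewrite -g_eq E.
  by have [] := H j u (CP jC) uF.
(* Outside all balls [0 <= y u] is needed, and it comes from [0 <= x j u <= y u] for any client
   [j]. *)
have [j jC] := C_inh; have [xu0 xu1] := H j u (CP jC) uF; exact: le_trans xu1.
Qed.

Let z0_out u : u \notin F -> z0 u = 0.
Proof.
move=> uF; rewrite /z0; case E : (g u) => [j|] //.
have /and3P[_ uF' _] : [&& j \in C, u \in F & inball j u] by rewrite -g_eq E.
by rewrite uF' in uF.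
Qed.

Let potential_z0 : potential z0 <= 5 `^ p * fm_cost P F d p f om x y.
Proof.
have fy0 : 0 <= \sum_(u in F) f u * y u.
  apply: sumr_ge0 => u uF; rewrite mulr_ge0 ?f0 //.
  exact: le_trans (z0_ge0 _) (z0_le uF).
rewrite /potential /fm_cost mulrDr; apply: lerD.
  apply: (@le_trans _ _ (\sum_(u in F) f u * y u)); last by rewrite ler_peMl.
  by apply: ler_sum => u uF; rewrite ler_wpM2l ?f0 ?z0_le.
rewrite mulr_sumr [X in _ <= X](big_setID C) /= (_ : P :&: C = C); last first.
  by apply/setIidPr/subsetP => j /CP.
rewrite -[X in X <= _]addr0; apply: lerD.
  apply: ler_sum => j jC.
  have -> : \sum_(u in F) om j * d j u `^ p * x j u = om j * avg j.
    by rewrite mulr_sumr; apply: eq_bigr => u _; rewrite mulrA.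
  by rewrite mulrCA ler_wpM2l ?charge_z0 // om0 ?CP.
apply: sumr_ge0 => v; rewrite inE => /andP[_ vP].
rewrite mulr_ge0 ?powR_ge0 //; apply: sumr_ge0 => u uF.
case: xy => _ _ H; have [xvu _] := H v u vP uF.
by rewrite !mulr_ge0 ?powR_ge0 ?om0.
Qed.

Variable M : {set T}.
Hypothesis MC : M \subset C.
Let conflict a b := [|| a == b, a == q b, q a == b | q a == q b].
Hypothesis M_indep : forall a b, a \in M -> b \in M -> conflict a b -> a = b.
Hypothesis M_dom : forall j, j \in C ->
  exists a, [/\ a \in M, D a <= D j & conflict a j].

(** Groups the balls by the chosen pair that owns their centre; disjointness of the chosen pairs
    makes the owner unique. *)
Let pair (k : option T) : option T :=
  if k is Some j then [pick a | (a \in M) && ((j == a) || (j == q a))] else None.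

Let pair_eq k a : a \in M ->
  (pair k == Some a) = (k == Some a) || (k == Some (q a)).
Proof.
move=> aM; case: k => [j|] //=; rewrite !(inj_eq Some_inj).
case: pickP => [b /andP[bM jb]|/(_ a)]; last by rewrite aM.
rewrite (inj_eq Some_inj); have [<-|ba] := eqVneq b a; first by rewrite jb.
apply/esym/negbTE/negP => ja; case/eqP: ba; apply: M_indep => //.
by rewrite /conflict; case/orP: jb => /eqP <-; case/orP: ja => /eqP <-;
  rewrite eqxx ?orbT.
Qed.

Let A : {set option T} := [set k | if k is Some j then j \in C else false].
Let B : {set option T} := [set k | if k is Some a then a \in M else false].
(** Elements outside [F] become loops, which extends the matroid to the whole type as the rounding
    theorem demands. *)
Let rF (S : {set T}) := r (S :&: F).

Let rF_card (S : {set T}) : (rF S <= #|S|)%N.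
Proof.
case: rM => r1 _ _; apply: leq_trans (r1 _ (subsetIr _ _)) _.
exact/subset_leq_card/subsetIl.
Qed.

Let rF_submod (S S' : {set T}) : (rF (S :|: S') + rF (S :&: S') <= rF S + rF S')%N.
Proof. by case: rM => _ _ r3; rewrite /rF setIUl setIIl r3 ?subsetIr. Qed.

Let z0_feasible : laminar_matroid_feasible rF g pair A B z0.
Proof.
split=> [||[j|]|[a|]]; rewrite 1?in_set //.
- move=> S; rewrite (big_setID F) /= [X in _ + X]big1 ?addr0; last first.
    by move=> u; rewrite inE => /andP[uF _]; apply: z0_out.
  case: xy => _ yr _; apply: le_trans (yr _ (subsetIr S F)).
  by apply: ler_sum => u; rewrite inE => /andP[_ uF]; apply: z0_le.
- by move=> jC; rewrite sum_z0 // x_in_out // gerBl outx0.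
- move=> aM; have aC := subsetP MC _ aM; have [qC qa _] := qP aC.
  under eq_bigl do rewrite pair_eq //.
  rewrite (bigID (fun u => g u == Some a)) /=.
  rewrite (eq_bigl (fun u => g u == Some a)); last first.
    by move=> u; case: eqP => //=; rewrite ?andbF.
  rewrite [X in _ + X](eq_bigl (fun u => g u == Some (q a))); last first.
    move=> u; have [->|] := eqVneq (g u) (Some a); last by rewrite andbT.
    by rewrite (inj_eq Some_inj) eq_sym (negPf qa).
  rewrite (sum_z0 aC) (sum_z0 qC) (x_in_out aC) (x_in_out qC).
  have := outx_half aC; have := outx_half qC; lra.
Qed.

Lemma separated_rounding_of_pairs :
  exists (xt : T -> T -> R) (yt : T -> R),
    [/\ fm_feasible P F r xt yt, fm_integral P F xt yt
      & fm_cost P F d p f om xt yt <= 5 `^ p * fm_cost P F d p f om x y].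
Proof.
have [z [Fz z01 cz]] := laminar_matroid_rounding rF_card rF_submod coeff z0_feasible.
have {cz} cz : potential z <= potential z0 by rewrite !potentialE lerD2r.
case: Fz => zge0 zr zA zB.
have open_in (Q : pred T) : 1 <= \sum_(u | Q u) z u -> exists2 u, Q u & z u = 1.
  move=> Q1; have [/existsP[u /andP[Qu /eqP zu]]|/existsPn no] :=
    boolP [exists u, Q u && (z u == 1)]; first by exists u.
  move: Q1; rewrite big1 ?ler10 // => u Qu.
  by have := no u; rewrite Qu /=; case: (z01 u) => // ->; rewrite eqxx.
have open_pair a : a \in M ->
    exists k u, [/\ (k == a) || (k == q a), g u = Some k & z u = 1].
  move=> aM; have [|u] := open_in (fun u => pair (g u) == Some a).
    by apply: zB; rewrite inE.
  rewrite pair_eq // => /orP[] /eqP gu zu.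
    by exists a, u; rewrite eqxx.
  by exists (q a), u; rewrite eqxx orbT.
have gF u k : g u = Some k -> [/\ k \in C, u \in F & inball k u].
  by move=> gu; apply/and3P; rewrite -g_eq gu.
have /choice[sg sgP] : forall v, exists u, v \in P ->
    [/\ u \in F, z u = 1 & v \in C -> d v u `^ p <= charge z v].
  move=> v; have [vC|vC] := boolP (v \in C); last first.
    (* Outside [C] nothing is asked of the distance, so any open facility will do, for instance one
       of a chosen pair. *)
    have [j /M_dom[a [aM _ _]]] := C_inh.
    by have [k [u [_ /gF[_ uF _] zu]]] := open_pair a aM; exists u.
  have charge_ge0 : 0 <= \sum_(u | g u == Some v) d v u `^ p * z u.
    by apply: sumr_ge0 => u _; rewrite mulr_ge0 ?powR_ge0.
  have zv1 : \sum_(u | g u == Some v) z u <= 1 by apply: zA; rewrite inE.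
  have [/existsP[u /andP[/eqP gu /eqP zu]]|/existsPn no] :=
      boolP [exists u, (g u == Some v) && (z u == 1)].
    exists u => _; have [_ uF _] := gF _ _ gu; split=> // _.
    rewrite /charge -[X in X <= _]addr0; apply: lerD.
      rewrite (bigD1 u) ?gu //= zu mulr1 lerDl sumr_ge0 // => u' _.
      by rewrite mulr_ge0 ?powR_ge0.
    by rewrite mulr_ge0 ?powR_ge0 // subr_ge0.
  (* No facility is open in the ball of [v], so its charge is at least [reroute v], which has to pay
     for the way to a chosen pair. *)
  have [a [aM Dav cav]] := M_dom vC; have aC := subsetP MC _ aM.
  have [qaC _ _] := qP aC; have [qvC _ _] := qP vC.
  have [k [u [ka gu zu]]] := open_pair a aM; have [kC uF ku] := gF _ _ gu.
  exists u => _; split=> // _.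
  rewrite /charge [X in reroute v * (_ - X)]big1; last first.
    move=> u' gu'; have := no u'; rewrite gu' /=.
    by case: (z01 u') => // ->; rewrite eqxx.
  rewrite subr0 mulr1; apply: le_trans (_ : reroute v <= _); last by rewrite lerDr.
  have [Da0 Dv0] := (D0 aC, D0 vC).
  have daa j : j \in C -> d j j = 0.
    by move=> jC; have [_ [_ ->]] := dm (CPF jC) (CPF jC) (CPF jC).
  have dqa : d (q a) a = D a by rewrite dC ?CPF.
  have dqv : d (q v) v = D v by rewrite dC ?CPF.
  (* [e] is a client common to the pairs of [v] and [a]; the detour runs from [v] over [e] and [k]
     to [u]. *)
  have [e [eC dve dek]] : exists e, [/\ e \in C, d v e <= D v & d e k <= D a].
    have de e : (e == a) || (e == q a) -> d e k <= D a.
      by case/orP => /eqP ->; case/orP: ka => /eqP ->; rewrite ?dqa ?daa.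
    case/or4P: cav => /eqP e.
    - by exists v; rewrite daa // de // -e eqxx.
    - by exists (q v); rewrite de // -e eqxx.
    - by exists v; rewrite daa // de // -e eqxx orbT.
    - by exists (q v); rewrite de // -e eqxx orbT.
  (* This bounds the last leg by [D a / 2]; with [D a <= D v] the detour is at most
     [5 / 2 * D v]. *)
  have Dk : D k <= D a by case/orP: ka => /eqP -> //; apply: D_q.
  have := dT (CPF vC) (CPF eC) (FPF uF); have := dT (CPF eC) (CPF kC) (FPF uF).
  move=> t1 t2; move: ku; rewrite /inball => ku.
  apply: ge0_ler_powR; rewrite ?nnegrE ?mulr_ge0 ?divr_ge0 ?(ltW p0) //.
    exact: d0 (CPF vC) (FPF uF).
  lra.
have sgF v : v \in P -> sg v \in F by case/sgP.
exists (fun v u => (u == sg v)%:R), z; split.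
- split=> [v vP|S SF|v u vP uF].
  + by rewrite (bigD1 (sg v)) ?sgF //= eqxx lerDl sumr_ge0.
  + by have := zr S; rewrite /rF (setIidPl SF).
  + split=> //; case: eqP => [->|_]; last exact: zge0.
    by have [_ -> _] := sgP v vP.
- by split=> [v u _ _|u _]; [case: eqP | case: (z01 u) => ->].
apply: le_trans (le_trans cz potential_z0); rewrite /fm_cost lerD2l.
have assign v : v \in P ->
    \sum_(u in F) om v * d v u `^ p * (u == sg v)%:R = om v * d v (sg v) `^ p.
  move=> vP; rewrite (bigD1 (sg v)) ?sgF //= eqxx mulr1 big1 ?addr0 //.
  by move=> u /andP[_ /negPf ->]; rewrite mulr0.
rewrite (big_setID C) /= (_ : P :&: C = C); last first.
  by apply/setIidPr/subsetP => j /CP.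
rewrite [X in _ + X]big1 ?addr0; last first.
  move=> v; rewrite !inE negb_and -leNgt => /andP[/orP[/negPf ->|ov] vP] //.
  rewrite assign //; have -> : om v = 0 by apply/eqP; rewrite eq_le ov om0.
  by rewrite mul0r.
apply: ler_sum => j jC; rewrite assign ?CP // ler_wpM2l ?om0 ?CP //.
by have [_ _] := sgP j (CP jC); apply.
Qed.

End SeparatedRounding.

Theorem separated_rounding (R : realType) (T : finType) (P F : {set T})
    (d : T -> T -> R) (p : R) (f om : T -> R) (r : {set T} -> nat)
    (x : T -> T -> R) (y : T -> R) :
  0 < p -> metric_on (P :|: F) d ->
  (forall u, u \in F -> 0 <= f u) -> (forall v, v \in P -> 0 <= om v) ->
  matroid_rank F r -> fm_feasible P F r x y ->
  (forall v, v \in P -> \sum_(u in F) x v u = 1) ->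
  (2 <= #|[set v in P | (0 < om v)%R]|)%N ->
  (forall a b, a \in [set v in P | 0 < om v] -> b \in [set v in P | 0 < om v] ->
     a != b -> 2 `^ (p + 1) * (\sum_(u in F) d a u `^ p * x a u) < d a b `^ p) ->
  exists (xt : T -> T -> R) (yt : T -> R),
    [/\ fm_feasible P F r xt yt, fm_integral P F xt yt
      & fm_cost P F d p f om xt yt <= 5 `^ p * fm_cost P F d p f om x y].
Proof.
move=> p0 dm f0 om0 rM xy x1 C2 sep.
have [q qP] := exists_nearest_neighbour d C2.
pose conflict a b := [|| a == b, a == q b, q a == b | q a == q b].
have cR : reflexive conflict by move=> a; rewrite /conflict eqxx.
have cS : symmetric conflict.
  move=> a b; rewrite /conflict (eq_sym b) (eq_sym (q b)) (eq_sym b) (eq_sym (q b) (q a)).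
  by rewrite [X in _ || X]orbCA.
have [M [MC Mi Md]] := greedy_independent_dominating (fun j => d j (q j))
  [set v in P | (0 < om v)%R] cR cS.
exact (separated_rounding_of_pairs p0 dm f0 om0 rM xy x1 C2 sep qP MC Mi Md).
Qed.

(** * From consolidated demands to the final bound *)

Lemma client_radius_powR (R : realType) (T : finType) (F : {set T})
    (d : T -> T -> R) (p : R) (x : T -> T -> R) (v : T) :
  0 < p -> (forall u, u \in F -> 0 <= x v u) ->
  client_radius F d p x v `^ p = \sum_(u in F) d v u `^ p * x v u.
Proof.
move=> p0 x0; rewrite /client_radius -powRrM mulVf ?gt_eqF // powRr1 //.
by apply: sumr_ge0 => u uF; rewrite mulr_ge0 ?powR_ge0 ?x0.
Qed.

Lemma sum_transportE (R : realType) (T : finType) (P F : {set T})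
    (d : T -> T -> R) (p : R) (om : T -> R) (x : T -> T -> R) :
  \sum_(v in P) \sum_(u in F) om v * d v u `^ p * x v u
  = \sum_(v in P) om v * \sum_(u in F) d v u `^ p * x v u.
Proof.
apply: eq_bigr => v _; rewrite mulr_sumr.
by apply: eq_bigr => u _; rewrite mulrA.
Qed.

Theorem mainTheorem19 (R : realType) (T : finType) (P F : {set T})
  (d : T -> T -> R) (p : R) (f : T -> R) (w : T -> R) (r : {set T} -> nat)
  (x : T -> T -> R) (y : T -> R) (s : seq T) :
  1 <= p ->
  metric_on (P :|: F) d ->
  (forall u, u \in F -> 0 <= f u) ->
  (forall v, v \in P -> 0 <= w v) ->
  matroid_rank F r ->
  fm_optimal P F r d p f w x y ->
  (forall v, v \in P -> \sum_(u in F) x v u = 1) ->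
  perm_eq s (enum P) ->
  sorted (fun a b => client_radius F d p x a <= client_radius F d p x b) s ->
  let w' := consolidate d p (client_radius F d p x) s w in
  (2 <= #|[set v in P | (0 < w' v)%R]|)%N ->
  exists (xt : T -> T -> R) (yt : T -> R),
    [/\ fm_feasible P F r xt yt, fm_integral P F xt yt
      & fm_cost P F d p f w' xt yt
          <= (4 * 3 `^ (p - 1) + 2) * 3 `^ p * fm_cost P F d p f w x y].
Proof.
move=> p1 dm f0 w0 rM [xy _] x1 sP srt w' C2.
have p0 : 0 < p by apply: lt_le_trans p1.
have su : uniq s by rewrite (perm_uniq sP) enum_uniq.
have sE v : (v \in s) = (v \in P) by rewrite (perm_mem sP) mem_enum.
have sA : {subset s <= P} by move=> v; rewrite sE.
have x0 v u : v \in P -> u \in F -> 0 <= x v u.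
  by case: xy => _ _ H vP uF; have [] := H v u vP uF.
pose rad := client_radius F d p x.
have rad0 v : 0 <= rad v := powR_ge0 _ _.
have radE v : v \in P -> rad v `^ p = \sum_(u in F) d v u `^ p * x v u.
  by move=> vP; apply: client_radius_powR => // u; apply: x0.
have pw : pairwise (fun a b => rad a <= rad b) s.
  by rewrite -sorted_pairwise // => b a c; apply: le_trans.
have w'0 : forall v, v \in P -> 0 <= w' v by apply: consolidate_ge0.
have sep a b : a \in [set v in P | 0 < w' v] -> b \in [set v in P | 0 < w' v] ->
    a != b -> 2 `^ (p + 1) * (\sum_(u in F) d a u `^ p * x a u) < d a b `^ p.
  rewrite !inE => /andP[aP wa] /andP[bP wb] ab.
  have dab : d a b = d b a.
    by have [] := dm a b b; rewrite ?inE ?aP ?bP.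
  have dab0 : 0 <= d a b by have [] := dm a b b; rewrite ?inE ?aP ?bP.
  suff far : 2 `^ ((p + 1) / p) * rad a < d a b.
    have -> : 2 `^ (p + 1) * (\sum_(u in F) d a u `^ p * x a u)
            = (2 `^ ((p + 1) / p) * rad a) `^ p.
      by rewrite powRM ?powR_ge0 // radE // -powRrM divfK ?gt_eqF.
    by apply: gt0_ltr_powR; rewrite ?nnegrE ?mulr_ge0 ?powR_ge0.
  have pw' := consolidate_separated d p rad su sA w0.
  (* The loop tests against the radius of the later client, which is the larger one in the sorted
     order; hence the bound holds with [rad a] whichever of [a] and [b] comes first in [s]. *)
  have := pairwise_relI (fun a b => rad a <= rad b) (fun a b =>
    [|| ~~ (d a b <= 2 `^ ((p + 1) / p) * rad b), w' a == 0 | w' b == 0]) s.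
  rewrite pw pw' => pw12.
  have := pairwise_or pw12 (_ : a \in s) (_ : b \in s) ab.
  rewrite !sE => /(_ aP bP) /=.
  rewrite !(gt_eqF wa) !(gt_eqF wb) !orbF -!ltNge => /orP[]/andP[rab].
    by apply: le_lt_trans; rewrite ler_wpM2l ?powR_ge0.
  by rewrite dab.
have [xt [yt [Ft It ct]]] := separated_rounding p0 dm f0 w'0 rM xy x1 C2 sep.
exists xt, yt; split=> //; apply: le_trans ct _.
have yu u : u \in F -> 0 <= y u.
  have /card_gt0P[v] : (0 < #|[set v in P | (0 < w' v)%R]|)%N by apply: leq_trans C2.
  rewrite inE => /andP[vP _] uF; case: xy => _ _ H.
  by have [] := H v u vP uF; apply: le_trans.
(* The fractional solution costs no more under [w'], since merging moves weight to clients of no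
   larger radius. *)
have ww' : fm_cost P F d p f w' x y <= fm_cost P F d p f w x y.
  rewrite /fm_cost lerD2l !sum_transportE.
  have rE (om : T -> R) : \sum_(v in P) om v * \sum_(u in F) d v u `^ p * x v u
      = \sum_(v in P) om v * rad v `^ p.
    by apply: eq_bigr => v vP; rewrite radE.
  rewrite !rE; apply: consolidate_sum_le => //.
  apply: sub_pairwise pw => a b rab.
  by apply: ge0_ler_powR => //; rewrite ?nnegrE //; apply: ltW.
have cost0 : 0 <= fm_cost P F d p f w x y.
  rewrite /fm_cost addr_ge0 ?sumr_ge0 // => [u uF|v vP].
    by rewrite mulr_ge0 ?f0 ?yu.
  by apply: sumr_ge0 => u uF; rewrite !mulr_ge0 ?powR_ge0 ?w0 ?x0.
apply: le_trans (_ : 5 `^ p * fm_cost P F d p f w x y <= _).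
  by rewrite ler_wpM2l ?powR_ge0.
rewrite ler_wpM2r //.
have le59 : 5 `^ p <= 3 `^ p * 3 `^ p :> R.
  rewrite -powRM //; apply: ge0_ler_powR; rewrite ?nnegrE ?mulr_ge0 //.
    exact: ltW.
  lra.
apply: le_trans le59 _; rewrite ler_wpM2r ?powR_ge0 //.
have -> : 3 `^ p = 3 * 3 `^ (p - 1) :> R.
  by rewrite -[p in LHS](subrK 1) [LHS]powRD ?pnatr_eq0 ?implybT // powRr1 // mulrC.
have : 0 <= 3 `^ (p - 1) :> R := powR_ge0 _ _.
lra.
Qed.
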